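(* The discrete semigroup $\mathbf{ID}_{\infty}$ does not embed topologically isomorphically into any Hausdorff sequentially compact topological semigroup; that is, for every Hausdorff sequentially compact topological semigroup $S$ there is no injective semigroup homomorphism $\mathbf{ID}_{\infty}\to S$ which is a homeomorphism of the discrete space $\mathbf{ID}_{\infty}$ onto its image with the subspace topology.
   Context: A partial cofinite isometry of the set of integers $\mathbb{Z}$ is a partial map $\alpha\colon\mathbb{Z}\rightharpoonup\mathbb{Z}$ such that $\mathbb{Z}\setminus\operatorname{dom}\alpha$ and $\mathbb{Z}\setminus\operatorname{ran}\alpha$ are finite and $|(x)\alpha-(y)\alpha|=|x-y|$ for all $x,y\in\operatorname{dom}\alpha$. $\mathbf{ID}_{\infty}$ is the semigroup (an inverse monoid) of all partial cofinite isometries of $\mathbb{Z}$ under composition of partial maps (maps written on the right). A topological semigroup is a topological space with a jointly continuous semigroup operation. A space is sequentially compact if every sequence in it has a convergent subsequence. *)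

(* Defs.v *)
From HB Require Import structures.
From mathcomp Require Import all_boot all_order all_algebra.
From mathcomp Require Import all_classical all_reals all_analysis.

Set Implicit Arguments.
Unset Strict Implicit.
Unset Printing Implicit Defensive.

Import Order.TTheory GRing.Theory Num.Theory.
Local Open Scope classical_set_scope.

Section PartialMaps.
Variables A B : Type.
Implicit Type f : A -> option B.

Definition pdom f : set A := [set x | exists y, f x = Some y].
Definition pran f : set B := [set y | exists x, f x = Some y].

End PartialMaps.

Record is_cofinite_isometry (f : int -> option int) : Prop := {
  cofinite_dom : finite_set (~` pdom f);
  cofinite_ran : finite_set (~` pran f);
  isometryP : forall x y x' y', f x = Some x' -> f y = Some y' ->
    (`|x' - y'| = `|x - y|)%R
}.

Record IDinf := MkIDinf {
  idinf_fun :> int -> option int;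
  idinf_funP : is_cofinite_isometry idinf_fun
}.

Lemma IDinf_eq (a b : IDinf) : idinf_fun a =1 idinf_fun b -> a = b.
Proof.
case: a b => [f fP] [g gP] /= /funext fg.
by case: _ / fg in gP *; congr MkIDinf; exact: Prop_irrelevance.
Qed.

Lemma isometry_inj f : is_cofinite_isometry f ->
  forall x y z, f x = Some z -> f y = Some z -> x = y.
Proof.
move=> fP x y z fx fy; have := isometryP fP fx fy.
by rewrite subrr normr0 => /esym/eqP; rewrite normr_eq0 subr_eq0 => /eqP.
Qed.

Lemma idinf_one_subproof : is_cofinite_isometry Some.
Proof.
have e (P : set int) : (forall x, P x) -> finite_set (~` P).
  by move=> PT; rewrite (_ : ~` P = set0)// -subset0 => x /(_ (PT x)).
split; [by apply: e => x; exists x|by apply: e => x; exists x|].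
by move=> x y _ _ [<-] [<-].
Qed.

Lemma idinf_mul_subproof (a b : IDinf) : is_cofinite_isometry (pcomp b a).
Proof.
case: a b => [f fP] [g gP] /=; split.
- pose h y := xget 0%R [set x | f x = Some y].
  have hP x y : f x = Some y -> h y = x.
    move=> fx; apply: (isometry_inj fP _ fx).
    by rewrite /h; case: xgetP => [_ -> //|/(_ x)].
  apply: (@sub_finite_set _ _ (~` pdom f `|` h @` ~` pdom g)).
    move=> x nx; case E: (f x) => [y|]; last by left => -[y]; rewrite E.
    right; exists y; last exact: hP.
    by move=> [z gy]; apply: nx; exists z; rewrite /pcomp E.
  by rewrite finite_setU; split; [exact: cofinite_dom fP|
    exact: finite_image (cofinite_dom gP)].
- apply: (@sub_finite_set _ _ (~` pran g `|` (odflt 0%R \o g) @` ~` pran f)).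
    move=> z nz; have [[y gy]|] := pselect (pran g z); last by left.
    right; exists y; last by rewrite /= gy.
    by move=> [x fx]; apply: nz; exists x; rewrite /pcomp fx.
  by rewrite finite_setU; split; [exact: cofinite_ran gP|
    exact: finite_image (cofinite_ran fP)].
- move=> x y x' y'; rewrite /pcomp.
  case fx: (f x) => [u|//]; case fy: (f y) => [v|//] /= gu gv.
  by rewrite (isometryP gP gu gv) (isometryP fP fx fy).
Qed.

(* Maps act on the right: [a * b] applies [a] first, then [b]. *)
Definition idinf_mul (a b : IDinf) : IDinf := MkIDinf (idinf_mul_subproof a b).
Definition idinf_one : IDinf := MkIDinf idinf_one_subproof.

Lemma idinf_mulA : associative idinf_mul.
Proof. by move=> a b c; apply: IDinf_eq => x /=; rewrite /pcomp/=; case: (a x). Qed.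

Lemma idinf_mul1 : left_id idinf_one idinf_mul.
Proof. by move=> a; apply: IDinf_eq. Qed.

Lemma idinf_1mul : right_id idinf_one idinf_mul.
Proof. by move=> a; apply: IDinf_eq => x /=; rewrite /pcomp/=; case: (a x). Qed.

HB.instance Definition _ := gen_eqMixin IDinf.
HB.instance Definition _ := gen_choiceMixin IDinf.
HB.instance Definition _ :=
  isMonoid.Build IDinf idinf_mulA idinf_mul1 idinf_1mul.
HB.instance Definition _ :=
  DiscreteTopology.copy IDinf (discrete_topology IDinf).

HB.mixin Record isTopologicalSemigroup S of Topological S & Semigroup S := {
  mulg_continuous : continuous (fun x : S * S => (x.1 * x.2)%g)
}.

#[short(type="topologicalSemigroupType")]
HB.structure Definition TopologicalSemigroup :=
  {S of Topological S & Semigroup S & isTopologicalSemigroup S}.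

(* On [nat], [increasing_seq] is strict monotonicity. The limit is quantified
   explicitly because [cvgn] requires a pointed space. *)
Definition sequentially_compact (T : topologicalType) : Prop :=
  forall u : nat -> T, exists2 k : nat -> nat, increasing_seq k &
    exists l : T, u \o k @ \oo --> l.

Definition homeomorphism (X Y : topologicalType) (f : X -> Y) : Prop :=
  continuous f /\
  exists g : Y -> X, [/\ cancel f g, cancel g f & continuous g].

(* [range f], coerced to a type, carries the subspace topology (the initial
   topology for [set_val]). *)
Definition corestriction (X : Type) (Y : topologicalType) (f : X -> Y)
  (x : X) : range f := SigSub (mem_set (imageT f x)).

(* Main.v *)
Require Import Defs.
From mathcomp Require Import all_boot all_order all_algebra.
From mathcomp Require Import all_classical all_reals all_analysis.

(** The translations form a copy of the group of integers inside the monoid, and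
    already this subgroup is an obstruction.  In a sequentially compact Hausdorff
    topological semigroup, suppose that a sequence [a] and a sequence [b] satisfy
    [a n * b n = e] for all [n].  Along a common subsequence [a] tends to some [l]
    and [b] to some [l'], and uniqueness of limits gives [l * l' = e].  Joint
    continuity at [(l, l')] lets the two indices move independently, so products
    [a m * b n] with [m] different from [n] accumulate at [e]
    ([offdiag_product_near]).

    For the images of the translations by [n] and by [-n] the value [e] is the
    image of the identity, while [a m * b n] is the image of the translation by
    [m - n], which is not the identity.  But an embedded discrete space has only
    isolated points ([embedding_isolated]), so no such product can be close to
    [e]. *)

Import Order.TTheory GRing.Theory Num.Theory.
Local Open Scope classical_set_scope.

Lemma cvg_subseq (T : topologicalType) (u : nat -> T) (k : nat -> nat) (l : T) :
  increasing_seq k -> u @ \oo --> l -> u \o k @ \oo --> l.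
Proof.
move=> kinc; apply: cvg_comp; apply/cvgnyPge => A.
exists A => // n /= An; apply: leq_trans An _.
by elim: n => // n /leq_ltn_trans; apply; rewrite (leqW_mono kinc).
Qed.

Lemma offdiag_product_near (S : topologicalSemigroupType)
    (hausS : hausdorff_space S) (scS : sequentially_compact S)
    (a b : nat -> S) (e : S) (V : set S) :
  (forall n, a n * b n = e)%g -> nbhs e V ->
  exists m n, m <> n /\ V (a m * b n)%g.
Proof.
move=> abe eV.
have [k kinc [l al]] := scS a.
have [k' k'inc [l' bl']] := scS (b \o k).
have {}al := @cvg_subseq _ _ _ _ k'inc al.
have mul_cvg : (a (k (k' n)) * b (k (k' n)))%g @[n --> \oo] --> (l * l')%g.
  exact: continuous2_cvg (mulg_continuous (l, l')) al bl'.
have ll' : (l * l')%g = e.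
  apply: (cvg_unique hausS mul_cvg) => /=.
  under eq_fun do rewrite abe.
  exact: cvg_cst.
have [[A B] /= [lA l'B] ABV] : nbhs (l, l') [set x | V (x.1 * x.2)%g].
  by apply: mulg_continuous; rewrite /= ll'.
have [N _ NA] := al A lA; have [M _ MB] := bl' B l'B.
(* Two distinct indices, both beyond N and M. *)
exists (k (k' (maxn N M))), (k (k' (maxn N M).+1)); split.
  move=> /(increasing_seq_injective kinc)/(increasing_seq_injective k'inc).
  by apply/eqP; rewrite neq_ltn ltnSn.
apply: (ABV (_, _)); split; first by apply: NA; exact: leq_maxl.
by apply: MB; rewrite /= leqW// leq_maxr.
Qed.

Lemma embedding_isolated (X : discreteTopologicalType) (Y : topologicalType)
    (f : X -> Y) (x : X) :
  homeomorphism (corestriction f) ->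
  exists2 V : set Y, nbhs (f x) V & forall y, V (f y) -> y = x.
Proof.
move=> [_ [g [fK _ gcont]]].
(* The preimage of the point x under the continuous inverse is open in the
   range, hence is the trace of an open set of Y. *)
have : nbhs (corestriction f x) (g @^-1` [set x]).
  by apply: gcont; rewrite fK nbhs_principalE.
rewrite nbhsE => -[_ [[V Vopen <-] Vx] Vg].
exists V; first by exists V.
by move=> y Vy; rewrite -(fK y); exact: (Vg (corestriction f y)).
Qed.

Lemma translation_subproof (z : int) :
  is_cofinite_isometry (fun x => Some (x + z)%R).
Proof.
have cofin (P : set int) : (forall x, P x) -> finite_set (~` P).
  by move=> PT; rewrite (_ : ~` P = set0)// -subset0 => x /(_ (PT x)).
split.
- by apply: cofin => x; exists (x + z)%R.
- by apply: cofin => x; exists (x - z)%R; rewrite subrK.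
- by move=> x y _ _ [<-] [<-]; rewrite opprD addrACA subrr addr0.
Qed.

Definition translation (z : int) : IDinf := MkIDinf (translation_subproof z).

Lemma translationM (z w : int) :
  (translation z * translation w)%g = translation (z + w)%R.
Proof. by apply: IDinf_eq => x /=; rewrite /pcomp/= addrA. Qed.

Lemma translation_inj : injective translation.
Proof. by move=> z w /(congr1 (idinf_fun^~ 0%R)) [] /=; rewrite !add0r. Qed.

Theorem mainTheorem9 (S : topologicalSemigroupType)
    (hausS : hausdorff_space S) (scS : sequentially_compact S) :
  ~ exists f : {multiplicative IDinf -> S},
      injective f /\ homeomorphism (corestriction f).
Proof.
move=> [f [_ fhomeo]].
have [V eV Ve] := @embedding_isolated _ _ f (translation 0%R) fhomeo.
pose a n := f (translation n%:Z); pose b n := f (translation (- n%:Z)%R).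
have ab m n : (a m * b n)%g = f (translation (m%:Z - n%:Z)%R).
  by rewrite -gmulfM translationM.
have abe n : (a n * b n)%g = f (translation 0%R) by rewrite ab subrr.
have [m [n [mn]]] := @offdiag_product_near _ hausS scS a b _ _ abe eV.
rewrite ab => /Ve /translation_inj /eqP.
by rewrite subr_eq0 => /eqP[].
Qed.
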